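(* Let $\mathbb{K}$ be a commutative field, $V$ a linear hyperplane of $\operatorname{M}_2(\mathbb{K})$, and $f : V \to \operatorname{M}_2(\mathbb{K})$ an injective linear map such that $f^{-1}(\operatorname{GL}_2(\mathbb{K}))=V \cap \operatorname{GL}_2(\mathbb{K})$. Then $f$ extends to a Frobenius automorphism of $\operatorname{M}_2(\mathbb{K})$.
   Context: A Frobenius automorphism of $\operatorname{M}_2(\mathbb{K})$ is a map of the form $M\mapsto PMQ$ or of the form $M \mapsto PM^TQ$ for some $P,Q\in\operatorname{GL}_2(\mathbb{K})$. *)

(* Defs.v *)
From mathcomp Require Import all_boot all_order all_algebra.

Set Implicit Arguments.
Unset Strict Implicit.
Unset Printing Implicit Defensive.

Import GRing.Theory.
Local Open Scope ring_scope.

Definition hyperplane (K : fieldType) (E : vectType K) (V : {vspace E}) : Prop :=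
  (\dim V).+1 = \dim {:E}.

(* [unitmx] is the set GL_2(K). *)
Definition Frobenius_automorphism (K : fieldType)
    (u : 'M[K]_2 -> 'M[K]_2) : Prop :=
  exists P Q : 'M[K]_2, [/\ P \in unitmx, Q \in unitmx
    & (forall M, u M = P *m M *m Q) \/ (forall M, u M = P *m M^T *m Q)].

(* Main.v *)
Require Import Defs.
From mathcomp Require Import all_boot all_order all_algebra.
From mathcomp Require Import ring.

(** The key point is that every hyperplane of 2 x 2 matrices contains two
    singular matrices whose sum is invertible, and that such a pair is
    equivalent to (E11, E22). In suitable coordinates [V] therefore consists of
    the matrices
<<
          [ x   ya ]
      P * [ y   z  ] * Q
>>
    ([hyperplane_equiv]): if [V] is the kernel of [M |-> tr (A M)], this form
    is read off the rank factorization of [A].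

    The images under [f] of the matrices at [(x, y, z) = (1, 0, 0)] and
    [(0, 0, 1)] are again singular with an invertible sum, so they are
    [P1 * E11 * Q1] and [P1 * E22 * Q1] ([singular_pair_equiv]). Write
    [P1 * [p, q; r, s] * Q1] for the image of the matrix at [(0, 1, 0)].
    Preservation of singularity at [y = 1] says that [x z = a] if and only if
    [(x + p) (z + s) = q r]; this forces [p = s = 0] and [q r = a]
    ([offdiag_of_singular_iff]), over every field. It remains to carry the
    off-diagonal pair [(a, 1)] to [(q, r)], where both pairs have the same
    product. If [r != 0], conjugation by [diag(1, r)] does it. If [r = 0], then
    [a = 0], and [q != 0] because [f] is injective: one transposes, and then
    conjugates by [diag(1, 1/q)]. *)

Set Implicit Arguments.
Unset Strict Implicit.
Unset Printing Implicit Defensive.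

Import GRing.Theory.
Local Open Scope ring_scope.

Section TwoByTwo.

Variable K : fieldType.
Implicit Types (a b c d p q r s x y z : K) (A M N P Q : 'M[K]_2).

(** The matrix with rows [(a, b)] and [(c, d)]. *)
Definition mx2 a b c d : 'M[K]_2 :=
  \matrix_(i, j) if i == 0 then (if j == 0 then a else b)
                 else (if j == 0 then c else d).

Lemma mx2P M : M = mx2 (M 0 0) (M 0 1) (M 1 0) (M 1 1).
Proof.
by apply/matrixP=> -[[|[|i]] Hi] // [[|[|j]] Hj] //; rewrite mxE /=;
  congr (M _ _); apply: val_inj.
Qed.

Lemma mx2_inj a b c d a' b' c' d' :
  mx2 a b c d = mx2 a' b' c' d' -> [/\ a = a', b = b', c = c' & d = d'].
Proof.
by move/matrixP=> E; move: (E 0 0) (E 0 1) (E 1 0) (E 1 1); rewrite !mxE.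
Qed.

Lemma mul_mx2 a b c d a' b' c' d' :
  mx2 a b c d *m mx2 a' b' c' d' =
  mx2 (a * a' + b * c') (a * b' + b * d') (c * a' + d * c') (c * b' + d * d').
Proof. by rewrite [LHS]mx2P !mxE !big_ord_recl !big_ord0 !mxE /= !addr0. Qed.

Lemma add_mx2 a b c d a' b' c' d' :
  mx2 a b c d + mx2 a' b' c' d' = mx2 (a + a') (b + b') (c + c') (d + d').
Proof. by rewrite [LHS]mx2P !mxE. Qed.

Lemma scale_mx2 k a b c d :
  k *: mx2 a b c d = mx2 (k * a) (k * b) (k * c) (k * d).
Proof. by rewrite [LHS]mx2P !mxE. Qed.

Lemma tr_mx2 a b c d : (mx2 a b c d)^T = mx2 a c b d.
Proof. by rewrite [LHS]mx2P !mxE. Qed.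

Lemma unit_mx2 a b c d : (mx2 a b c d \in unitmx) = (a * d != b * c).
Proof.
rewrite unitmxE unitfE (expand_det_row _ 0) !big_ord_recl big_ord0.
rewrite /cofactor !det_mx11 !mxE /= addr0 expr0 expr1 mul1r mulN1r mulrN.
by rewrite subr_eq0.
Qed.

Lemma mx2_eq0 a b c d : mx2 a b c d = 0 -> [/\ a = 0, b = 0, c = 0 & d = 0].
Proof.
by move=> E; apply: mx2_inj; rewrite E [LHS]mx2P !mxE.
Qed.

Lemma unit_equiv P Q M :
  P \in unitmx -> Q \in unitmx -> (P *m M *m Q \in unitmx) = (M \in unitmx).
Proof. by move=> uP uQ; rewrite !unitmx_mul uP uQ andbT. Qed.

Lemma mul2mx_comb P Q x y z A B C :
  x *: (P *m A *m Q) + y *: (P *m B *m Q) + z *: (P *m C *m Q) =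
  P *m (x *: A + y *: B + z *: C) *m Q.
Proof. by rewrite !mulmxDr !mulmxDl -!scalemxAr -!scalemxAl. Qed.

(** Two singular matrices with invertible sum have independent column spaces
    and independent row spaces, hence are simultaneously equivalent to [E11]
    and [E22]. *)
Lemma singular_pair_equiv A B :
  A \notin unitmx -> B \notin unitmx -> A + B \in unitmx ->
  exists P Q, [/\ P \in unitmx, Q \in unitmx,
    A = P *m mx2 1 0 0 0 *m Q & B = P *m mx2 0 0 0 1 *m Q].
Proof.
move=> sA sB uAB.
have rA : \rank A = 1%N.
  (* A = 0 is impossible because B is singular and A + B is not. *)
  have : \rank A != 0%N.
    by rewrite mxrank_eq0; apply: contraNneq sB => A0; rewrite A0 add0r in uAB.
  have : \rank A != 2%N by rewrite -row_free_unit in sA.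
  by have := rank_leq_row A; case: (\rank A) => [|[|[|?]]].
have := mulmx_ebase A; rewrite rA.
have -> : pid_mx 1 = mx2 1 0 0 0 by rewrite [LHS]mx2P !mxE.
move: (col_ebase_unit A) (row_ebase_unit A).
move: (col_ebase A) (row_ebase A) => L R uL uR defA.
have [C defB] : exists C, B = L *m C *m R.
  by exists (invmx L *m B *m invmx R); rewrite -mulmxA !mulmxKV //
    mulmxA mulmxV // mul1mx.
subst A B; rewrite -mulmxDl -mulmxDr unit_equiv // in uAB.
rewrite unit_equiv // in sB.
move: uAB sB; rewrite (mx2P C).
move: (C 0 0) (C 0 1) (C 1 0) (C 1 1) => p q r s.
rewrite add_mx2 !unit_mx2 !add0r negbK => u /eqP e.
have s0 : s != 0.
  by move: u; apply: contraNneq => s0; rewrite s0 mulr0 -e s0 mulr0.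
(* With p s = q r, the rank one matrix [p, q; r, s] is (q / s, 1)^T (r, s);
   the two triangular factors have it as second column, resp. second row, and
   leave E11 unchanged. *)
exists (L *m mx2 1 (q / s) 0 1), (mx2 1 0 r s *m R).
rewrite !unitmx_mul uL uR !unit_mx2 !mul0r mulr0 !mulr1 !mul1r oner_eq0 s0.
have assoc U X W : L *m U *m X *m (W *m R) = L *m (U *m X *m W) *m R.
  by rewrite !mulmxA.
split=> //; rewrite assoc !mul_mx2; congr (L *m mx2 _ _ _ _ *m R); try by field.
by rewrite -[p](mulfK s0) e; field.
Qed.

(** The trace form identifies linear forms on matrices with matrices; here the
    form is the coordinate of the projection along [V] onto the line [V^C]. *)
Lemma hyperplane_mxtrace (V : {vspace 'M[K]_2}) : hyperplane V ->
  exists2 A, A != 0 & forall M, (M \in V) = (\tr (A *m M) == 0).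
Proof.
move=> hV.
have dVC : \dim V^C = 1%N by rewrite dimv_compl -hV subSnn.
have capV : (V :&: V^C = 0)%VS := capv_compl V.
pose i0 : 'I_(\dim V^C) := cast_ord (esym dVC) ord0.
pose pi := daddv_pi V^C V.
pose phi M : K := coord (vbasis V^C) i0 (pi M).
have phi0 M : (phi M == 0) = (M \in V).
  have piVM := daddv_pi_add capV (_ : M \in V + V^C)%VS.
  have {}piVM : daddv_pi V V^C M + pi M = M by apply: piVM; rewrite addv_complf memvf.
  apply/eqP/idP=> [phiM0|VM]; last first.
    move: piVM; rewrite daddv_pi_id // => /(canRL (addKr _)).
    by rewrite addNr /phi => ->; rewrite linear0.
  suff pi0 : pi M = 0 by rewrite -piVM pi0 addr0 memv_pi.
  rewrite (coord_vbasis (memv_pi V^C V M)) big1 // => i _.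
  suff -> : i = i0 by rewrite -/pi -/(phi M) phiM0 scale0r.
  by apply: val_inj; case: i => i /= lti; move: lti;
    rewrite [X in (_ < X)%N]dVC; case: i.
pose A : 'M[K]_2 := \matrix_(i, j) phi (delta_mx j i).
have trA M : \tr (A *m M) = phi M.
  rewrite [in RHS](matrix_sum_delta M) /phi !linear_sum /=.
  rewrite mxtrace_mulC; apply: eq_bigr => i _.
  rewrite !linear_sum !mxE; apply: eq_bigr => j _.
  by rewrite !linearZ mxE.
exists A => [|M]; last by rewrite trA phi0.
apply: contra_eq_neq hV => A0.
suff -> : V = fullv by rewrite neq_ltn ltnSn orbT.
by apply/vspaceP=> M; rewrite memvf -phi0 -trA A0 mul0mx mxtrace0 eqxx.
Qed.

(** Normal form of a hyperplane up to equivalence: the proof gives [a = 0] when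
    the matrix representing the linear form has rank 1 ([V] is then equivalent
    to the space of triangular matrices), and [a = -1] when it has rank 2. *)
Lemma hyperplane_equiv (V : {vspace 'M[K]_2}) : hyperplane V ->
  exists P Q a, [/\ P \in unitmx, Q \in unitmx &
    forall M, M \in V <-> exists x y z, M = P *m mx2 x (y * a) y z *m Q].
Proof.
case/hyperplane_mxtrace=> A A0 defV.
(* A is nonzero, so e = 0 if A has rank 1 and e = 1 if it has rank 2. *)
have [e defD] : exists e, pid_mx (\rank A) = mx2 1 0 0 e.
  rewrite -mxrank_eq0 in A0; exists (1 < \rank A)%N%:R.
  rewrite [LHS]mx2P !mxE /= -lt0n in A0 *; rewrite A0.
  by case: (1 < _)%N.
have := mulmx_ebase A; rewrite defD.
move: (col_ebase_unit A) (row_ebase_unit A).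
move: (col_ebase A) (row_ebase A) => L R uL uR defA.
(* The condition N 0 0 + e * N 1 1 = 0 leaves the off-diagonal entries of N
   free; exchanging the columns moves them to the diagonal. *)
pose J := mx2 0 1 1 0.
have JJ : J *m J = 1%:M.
  by rewrite mul_mx2 [RHS]mx2P !mxE /= !mul0r !mulr0 !mul1r !addr0 !add0r.
have uJ : J \in unitmx by rewrite unit_mx2 mul0r mulr1 eq_sym oner_eq0.
exists (invmx R), (J *m invmx L), (- e).
rewrite unitmx_mul !unitmx_inv uJ; split=> // M.
have -> : M \in V = (\tr (mx2 1 0 0 e *m (R *m M *m L)) == 0).
  by rewrite defV -defA -!mulmxA mxtrace_mulC !mulmxA.
have trE N : \tr (mx2 1 0 0 e *m N) = N 0 0 + e * N 1 1.
  rewrite (mx2P N) mul_mx2 /mxtrace !big_ord_recl big_ord0 !mxE /=.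
  by ring.
split=> [|[x [y [z ->]]]]; last first.
  rewrite -!mulmxA mulKVmx // mulVmx // mulmx1 mul_mx2 trE !mxE /=.
  by apply/eqP; ring.
rewrite trE; set N := R *m M *m L => /eqP trN.
exists (N 0 1), (N 1 1), (N 1 0).
have -> : mx2 (N 0 1) (N 1 1 * - e) (N 1 1) (N 1 0) = N *m J.
  rewrite {5}(mx2P N) mul_mx2; congr mx2; try by ring.
  rewrite (_ : N 0 0 = - (e * N 1 1)); first by ring.
  by apply/eqP; rewrite -addr_eq0 trN.
by rewrite -!mulmxA (mulmxA J) JJ mul1mx mulmxV // mulmx1 mulKmx.
Qed.

(** The affine map [z |-> p (z + s)] is onto when [p] is nonzero, so it cannot
    always take, or never take, the value [c]. *)
Lemma slope_eq0 p s c (b : bool) : (forall z, (p * (z + s) == c) = b) -> p = 0.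
Proof.
move=> H; apply/eqP; apply: contraT => p0.
(* The value at c / p - s is c, and the value at c / p - s + p^-1 is c + 1. *)
have H1 := H (c / p - s); have H2 := H (c / p - s + p^-1).
move: H1 H2; rewrite subrK mulrC divfK // eqxx => <-.
rewrite addrAC subrK mulrC mulrDl divfK // mulVf //.
by rewrite -subr_eq0 addrC addKr oner_eq0.
Qed.

(** The hyperbola [x z = a] determines its centre and its constant, even over
    very small fields and for [a = 0]. *)
Lemma offdiag_of_singular_iff a p q r s :
    (forall x z, ((x + p) * (z + s) == q * r) = (x * z == a)) ->
  [/\ p = 0, s = 0 & q * r = a].
Proof.
move=> H.
have p0 : p = 0.
  by apply: (@slope_eq0 p s (q * r) (0 == a)) => z; rewrite -[p]add0r H mul0r.
have s0 : s = 0.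
  apply: (@slope_eq0 s p (q * r) (0 == a)) => x.
  by rewrite mulrC -[s]add0r H mulr0.
split=> //; apply/eqP; have := H 1 a.
by rewrite p0 s0 !addr0 mul1r eqxx eq_sym.
Qed.

Lemma mul_diag_mx2 d x y z w : d != 0 ->
  mx2 1 0 0 d^-1 *m mx2 x y w z *m mx2 1 0 0 d = mx2 x (y * d) (w / d) z.
Proof. by move=> d0; rewrite !mul_mx2; congr mx2; field. Qed.

End TwoByTwo.

Theorem proposition23 (K : fieldType) (V : {vspace 'M[K]_2})
    (f : {linear subvs_of V -> 'M[K]_2}) :
  hyperplane V ->
  injective f ->
  (forall M : subvs_of V, (f M \in unitmx) = (vsval M \in unitmx)) ->
  exists u : 'M[K]_2 -> 'M[K]_2,
    Frobenius_automorphism u /\ (forall M : subvs_of V, u (vsval M) = f M).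
Proof.
move=> /hyperplane_equiv[P [Q [a [uP uQ defV]]]] injf unitf.
(* Coordinates (x, y, z) on V, and f read in these coordinates. *)
pose h x y z := P *m mx2 x (y * a) y z *m Q.
have Vh x y z : h x y z \in V by apply/defV; exists x, y, z.
pose g x y z := f (vsproj V (h x y z)).
have gE x y z : g x y z = x *: g 1 0 0 + y *: g 0 1 0 + z *: g 0 0 1.
  have hE : h x y z = x *: h 1 0 0 + y *: h 0 1 0 + z *: h 0 0 1.
    rewrite /h mul2mx_comb !scale_mx2 !add_mx2.
    by congr (_ *m mx2 _ _ _ _ *m _); ring.
  by rewrite /g hE; move: (h 1 0 0) (h 0 1 0) => M N; rewrite !linearD !linearZ.
have unitg x y z : (g x y z \in unitmx) = (x * z != y * a * y).
  by rewrite unitf vsprojK // unit_equiv // unit_mx2.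
have [||| P1 [Q1 [uP1 uQ1 g1 g3]]] := @singular_pair_equiv _ (g 1 0 0) (g 0 0 1).
- by rewrite unitg !mul0r mulr0 eqxx.
- by rewrite unitg !mul0r eqxx.
- by have := unitg 1 0 1; rewrite gE !scale1r scale0r addr0 => ->;
    rewrite mulr1 mulr0 oner_eq0.
have [p [q [r [s g2]]]] : exists p q r s, g 0 1 0 = P1 *m mx2 p q r s *m Q1.
  pose N := invmx P1 *m g 0 1 0 *m invmx Q1.
  exists (N 0 0), (N 0 1), (N 1 0), (N 1 1).
  by rewrite -mx2P /N -!mulmxA mulVmx // mulmx1 mulKVmx.
have {}gE x y z :
    g x y z = P1 *m mx2 (x + y * p) (y * q) (y * r) (z + y * s) *m Q1.
  rewrite gE g1 g2 g3 mul2mx_comb !scale_mx2 !add_mx2.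
  by congr (_ *m mx2 _ _ _ _ *m _); ring.
have [p0 s0 qr] : [/\ p = 0, s = 0 & q * r = a].
  apply: offdiag_of_singular_iff => x z; apply: negb_inj.
  by have := unitg x 1 z; rewrite gE unit_equiv // unit_mx2 !mul1r mulr1 => ->.
have gE' x y z : g x y z = P1 *m mx2 x (y * q) (y * r) z *m Q1.
  by rewrite gE p0 s0 !mulr0 !addr0.
have fE M : exists x y z, vsval M = h x y z /\ f M = g x y z.
  have /defV[x [y [z defM]]] := subvsP M; exists x, y, z.
  by rewrite /g -[h x y z]defM vsvalK.
have [r0|r0] := eqVneq r 0; last first.
  have ur : mx2 1 0 0 r \in unitmx by rewrite unit_mx2 mul1r mulr0.
  have urV : mx2 1 0 0 r^-1 \in unitmx by rewrite unit_mx2 mul1r mulr0 invr_eq0.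
  pose P2 := P1 *m mx2 1 0 0 r *m invmx P.
  pose Q2 := invmx Q *m mx2 1 0 0 r^-1 *m Q1.
  exists (fun M => P2 *m M *m Q2); split.
    exists P2, Q2; rewrite !unitmx_mul !unitmx_inv uP uQ uP1 uQ1 ur urV.
    by split=> //; left.
  move=> M; have [x [y [z [-> ->]]]] := fE M; rewrite gE' /h /P2 /Q2.
  rewrite -!mulmxA mulKmx // mulKVmx // !mulmxA; congr (_ *m _).
  rewrite -!mulmxA; congr (_ *m _); rewrite mulmxA.
  have := @mul_diag_mx2 _ r^-1 x (y * a) z y; rewrite invr_eq0 invrK => -> //.
  by rewrite -qr; congr mx2; field.
(* Here r = 0, so a transposition is needed; q = 0 would put the nonzero
   matrix h 0 1 0 in the kernel of f. *)
have q0 : q != 0.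
  apply/eqP=> q0; have /injf/(congr1 vsval) : g 0 1 0 = f 0.
    by rewrite gE' q0 r0 linear0 !mulr0 [mx2 _ _ _ _](_ : _ = 0) ?mulmx0 ?mul0mx //;
      rewrite [RHS]mx2P !mxE.
  rewrite vsprojK // linear0 /h => /(canRL (mulmxK uQ)); rewrite mul0mx.
  move/(canRL (mulKmx uP)); rewrite mulmx0 => /mx2_eq0[_ _ /eqP].
  by rewrite oner_eq0.
have a0 : a = 0 by rewrite -qr r0 mulr0.
have uq : mx2 1 0 0 q \in unitmx by rewrite unit_mx2 mul1r mulr0.
have uqV : mx2 1 0 0 q^-1 \in unitmx by rewrite unit_mx2 mul1r mulr0 invr_eq0.
pose P2 := P1 *m mx2 1 0 0 q^-1 *m invmx Q^T.
pose Q2 := invmx P^T *m mx2 1 0 0 q *m Q1.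
exists (fun M => P2 *m M^T *m Q2); split.
  exists P2, Q2; rewrite !unitmx_mul !unitmx_inv !unitmx_tr uP uQ uP1 uQ1 uq uqV.
  by split=> //; right.
move=> M; have [x [y [z [-> ->]]]] := fE M; rewrite gE' /h /P2 /Q2.
rewrite !trmx_mul tr_mx2 -!mulmxA mulKmx ?unitmx_tr // mulKVmx ?unitmx_tr //.
rewrite !mulmxA; congr (_ *m _).
rewrite -!mulmxA; congr (_ *m _); rewrite mulmxA mul_diag_mx2 //.
by rewrite a0 r0 !mulr0 mul0r.
Qed.
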